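(* Let $E$ be a real uniformly smooth Banach space whose modulus of smoothness satisfies $\rho_E(\tau)\le K\tau^q$ for all $\tau>0$, for some $1<q\le 2$ and some constant $K>0$. Let $J:E\to E^*$ be the normalized duality mapping. Then there is a constant $M$ such that for all $x,y\in E$ $$\|J(x)-J(y)\|\le M\,\|x-y\|^{q-1}\,\max\{\|x\|,\|y\|\}^{2-q}.$$ In particular, if $E$ is a $2$-uniformly smooth Banach space, then its duality mapping $J$ is Lipschitz continuous.
   Context: The normalized duality mapping of $E$ is $Jx=\{x^*\in E^*:\langle x,x^*\rangle=\|x\|^2=\|x^*\|^2\}$; when $E$ is smooth (in particular uniformly smooth), $Jx$ is a singleton for every $x$ and $J$ is regarded as a map $E\to E^*$. The modulus of smoothness of $E$ is $$\rho_E(\tau)=\sup\left\{\frac{\|x+\tau y\|+\|x-\tau y\|}{2}-1:\ \|x\|=\|y\|=1\right\}.$$ $E$ is uniformly smooth if $\rho_E(\tau)/\tau\to 0$ as $\tau\to 0$. For $1<p\le 2$, $E$ is $p$-uniformly smooth if there is a constant $K>0$ with $\rho_E(\tau)\le K\tau^p$ for all $\tau>0$. The norm on $E^*$ is the dual norm. *)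

(* Defs.v *)
From HB Require Import structures.
From mathcomp Require Import all_boot all_order all_algebra.
From mathcomp Require Import all_classical all_reals all_analysis.

Set Implicit Arguments.
Unset Strict Implicit.
Unset Printing Implicit Defensive.

Import Order.TTheory GRing.Theory Num.Theory.
Import numFieldNormedType.Exports.

Local Open Scope classical_set_scope.
Local Open Scope ring_scope.

Section Dual.
Context {R : realType} (E : normedModType R).

Definition linear_continuous_pred : {pred (E -> R^o)} :=
  [pred f : E -> R^o | `[< linear f /\ continuous f >]].

Record dual := Dual {
  dual_fun :> E -> R^o ;
  dual_funP : dual_fun \in linear_continuous_pred }.

HB.instance Definition _ := [isSub for dual_fun].
HB.instance Definition _ := [Choice of dual by <:].

Fact dual_submod_closed : submod_closed linear_continuous_pred.
Proof.
split=> [|a f g /asboolP[lf cf] /asboolP[lg cg]]; apply/asboolP; split.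
- by move=> a u v /=; rewrite scaler0 addr0.
- exact: cst_continuous.
- move=> b u v.
  rewrite -[LHS]/(a *: f (b *: u + v) + g (b *: u + v)) lf lg.
  by rewrite !scalerDr addrACA !scalerA mulrC.
- move=> x; apply: (@cvgD _ _ _ _ _ (a \*: f : E -> R^o) g); last exact: cg.
  by apply: cvgZr; exact: cf.
Qed.

HB.instance Definition _ := GRing.isSubmodClosed.Build _ _
  linear_continuous_pred dual_submod_closed.
HB.instance Definition _ := [SubChoice_isSubLmodule of dual by <:].

Lemma dual_linear (f : dual) : linear f.
Proof. by have /asboolP[] := dual_funP f. Qed.

Lemma dual_continuous (f : dual) : continuous f.
Proof. by have /asboolP[] := dual_funP f. Qed.

HB.instance Definition _ (f : dual) :=
  GRing.isLinear.Build R E R^o *:%R f (dual_linear f).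

Definition dual_norm (f : dual) : R :=
  sup [set `|f x| | x in [set x : E | `|x| <= 1]].

Lemma dual_norm_has_sup (f : dual) :
  has_sup [set `|f x| | x in [set x : E | `|x| <= 1]].
Proof.
split; first by exists `|f 0|, 0 => //=; rewrite normr0.
have /linear_boundedP/pinfty_ex_gt0[M M0 fM] :
    bounded_near f (nbhs (0 : E)).
  by apply: continuous_linear_bounded; exact: dual_continuous.
exists M => _ [x /= x1 <-]; apply: le_trans (fM x) _.
by rewrite ler_piMr// ltW.
Qed.

Lemma dual_norm_ub (f : dual) (x : E) : `|x| <= 1 -> `|f x| <= dual_norm f.
Proof.
move=> x1; apply: ub_le_sup; last by exists x.
by have [] := dual_norm_has_sup f.
Qed.

Lemma dual_norm_le (f : dual) (M : R) :
  (forall x : E, `|x| <= 1 -> `|f x| <= M) -> dual_norm f <= M.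
Proof.
move=> fM; apply: ge_sup; first by have [] := dual_norm_has_sup f.
by move=> _ [x /= x1 <-]; exact: fM.
Qed.

Lemma dual_norm_ge0 (f : dual) : 0 <= dual_norm f.
Proof. by apply: le_trans (dual_norm_ub f (x := 0) _); rewrite ?normr0. Qed.

Fact dual_normD (f g : dual) : dual_norm (f + g) <= dual_norm f + dual_norm g.
Proof.
apply: dual_norm_le => x x1; apply: le_trans (ler_normD _ _) _.
by apply: lerD; exact: dual_norm_ub.
Qed.

Fact dual_normZ_le (a : R) (f : dual) : dual_norm (a *: f) <= `|a| * dual_norm f.
Proof.
apply: dual_norm_le => x x1.
by rewrite [X in X <= _](normrM a (f x)) ler_wpM2l// dual_norm_ub.
Qed.

Fact dual_normZ (a : R) (f : dual) : dual_norm (a *: f) = `|a| * dual_norm f.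
Proof.
apply/eqP; rewrite eq_le dual_normZ_le/=.
have [->|a0] := eqVneq a 0; first by rewrite normr0 mul0r dual_norm_ge0.
rewrite -ler_pdivlMl ?normr_gt0// -normfV.
by rewrite -[in leLHS](scalerK a0 f) dual_normZ_le.
Qed.

Fact dual_norm_eq0 (f : dual) : dual_norm f = 0 -> f = 0.
Proof.
move=> f0; apply/val_inj/funext => x.
have f1 y : `|y| <= 1 -> f y = 0.
  by move=> /(dual_norm_ub f); rewrite f0 normr_le0 => /eqP.
have [->|x0] := eqVneq x 0; first by rewrite [LHS]linear0.
rewrite -[x in LHS](scalerKV (_ : `|x| != 0)) ?normr_eq0//.
rewrite [LHS]linearZ/= f1 ?scaler0// normrZ normfV normr_id.
by rewrite mulVf ?normr_eq0.
Qed.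

HB.instance Definition _ := Lmodule_isNormed.Build R dual
  dual_normD dual_normZ dual_norm_eq0.

End Dual.

Section Smoothness.
Context {R : realType} (E : normedModType R).

Definition duality_set (x : E) : set (dual E) :=
  [set f : dual E | f x = `|x| ^+ 2 /\ `|f| ^+ 2 = `|x| ^+ 2].

(* [duality_set x] is a singleton when [E] is smooth; its element is then
   [duality_map x].  The value [0] is a default for an empty [duality_set x]. *)
Definition duality_map (x : E) : dual E := xget 0 (duality_set x).

(* The set is bounded by [`|t|], so that the real-valued [sup] is the actual
   supremum, except that it is [0] when [E] is the null space. *)
Definition smoothness_modulus (t : R) : R :=
  sup [set (`|z.1 + t *: z.2| + `|z.1 - t *: z.2|) / 2 - 1
      | z in [set z : E * E | `|z.1| = 1 /\ `|z.2| = 1]].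

(* The modulus is considered for [t > 0] only, hence the right limit. *)
Definition uniformly_smooth : Prop :=
  smoothness_modulus t / t @[t --> 0^'+] --> 0.

Definition power_uniformly_smooth (p : R) : Prop :=
  exists2 K : R, 0 < K &
    forall t : R, 0 < t -> smoothness_modulus t <= K * t `^ p.

End Smoothness.

Arguments uniformly_smooth {R} E.
Arguments smoothness_modulus {R} E t.
Arguments power_uniformly_smooth {R} E p.

(* Main.v *)
(** For [f] in the duality set of [x] and [g] in that of [y], the subgradient
    inequality [f h <= (|x + h|^2 - |x|^2) / 2] bounds [(f - g) (r z)] by
    [(|x + r z|^2 + |y - r z|^2 - |x|^2 - |y|^2) / 2].  With [m = (x + y) / 2]
    and [k = (x - y) / 2 + r z] the two moved points are [m + k] and [m - k],
    and [|x|^2 + |y|^2 >= 2 |m|^2], so that what remains is the symmetric second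
    difference of the squared norm at [m], which the modulus of smoothness
    controls; the choice [r = |x - y| / 2] gives the estimate.  The duality sets
    are nonempty without the Hahn-Banach theorem: in a uniformly smooth space
    the one-sided directional derivative of the norm is linear. *)
Require Import Defs.
From HB Require Import structures.
From mathcomp Require Import all_boot all_order all_algebra.
From mathcomp Require Import all_classical all_reals all_analysis.
From mathcomp Require Import ring lra.

Set Implicit Arguments.
Unset Strict Implicit.
Unset Printing Implicit Defensive.

Import Order.TTheory GRing.Theory Num.Theory.
Import numFieldNormedType.Exports.

Local Open Scope classical_set_scope.
Local Open Scope ring_scope.

(** * The dual norm and the subgradient inequality *)

Section DualNorm.
Context {R : realType} {E : normedModType R}.

Lemma dual_normM_ub (f : dual E) (x : E) : `|f x| <= `|f| * `|x|.
Proof.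
have [->|x0] := eqVneq x 0; first by rewrite linear0 !normr0 mulr0.
have nx : `|x| != 0 by rewrite normr_eq0.
rewrite -{1}[x](scalerKV nx) linearZ/= normrM normr_id mulrC ler_wpM2r//.
by apply: dual_norm_ub; rewrite normrZ normfV normr_id mulVf.
Qed.

Lemma dual_subE (f g : dual E) (x : E) : (f - g) x = f x - g x.
Proof. by []. Qed.

(** Since [|f| = |x|], one has [f (x + h) <= |x| |x + h|]; bounding this product by half the sum of
    the squares and subtracting [f x = |x|^2] gives the claim. *)
Lemma duality_set_subgradient (x h : E) (f : dual E) :
  duality_set x f -> f h <= (`|x + h| ^+ 2 - `|x| ^+ 2) / 2.
Proof.
move=> [fx nf].
have {}nf : `|f| = `|x|.
  by apply/eqP; rewrite -(@eqrXn2 _ 2)// nf.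
have := le_trans (ler_norm _) (dual_normM_ub f (x + h)).
rewrite linearD/= fx nf => H.
have := sqr_ge0 (`|x| - `|x + h|); nra.
Qed.

End DualNorm.

(** * The modulus of smoothness and second differences of the norm *)

Section Modulus.
Context {R : realType} (E : normedModType R).
Implicit Types (x y h m k : E) (t K q : R).

Lemma smoothness_modulus_ub t x y : `|x| = 1 -> `|y| = 1 ->
  (`|x + t *: y| + `|x - t *: y|) / 2 - 1 <= smoothness_modulus E t.
Proof.
move=> x1 y1; apply: ub_le_sup; last by exists (x, y).
exists `|t| => _ [[u v] /= [u1 v1] <-].
have := ler_normD u (t *: v); have := ler_normB u (t *: v).
rewrite normrZ u1 v1 mulr1; lra.
Qed.

Lemma smoothness_modulus_ge0 t : 0 <= smoothness_modulus E t.
Proof.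
rewrite /smoothness_modulus; set A := (X in sup X).
(* Without unit vectors the set is empty and its [sup] is 0 by convention. *)
have [->|/set0P[_ [[x y] /= [x1 y1] _]]] := eqVneq A set0; first by rewrite sup0.
apply: (le_trans _ (smoothness_modulus_ub t x1 y1)).
have := ler_normD (x + t *: y) (x - t *: y).
rewrite addrACA subrr addr0 -mulr2n normrMn x1; lra.
Qed.

(** Homogeneity: normalize [x] and [h], apply the definition of the modulus at [|h| / |x|], and
    multiply back by [|x|]. *)
Lemma norm_second_difference x h : x != 0 ->
  `|x + h| + `|x - h| <=
    2 * `|x| * (1 + smoothness_modulus E (`|h| / `|x|)).
Proof.
move=> x0; have nx : 0 < `|x| by rewrite normr_gt0.
have nx0 : `|x| != 0 by rewrite gt_eqF.
have [->|h0] := eqVneq h 0.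
  rewrite subr0 addr0.
  have := smoothness_modulus_ge0 (`|0 : E| / `|x|); nra.
have nh0 : `|h| != 0 by rewrite normr_eq0.
pose u := `|x|^-1 *: x; pose v := `|h|^-1 *: h.
have u1 : `|u| = 1 by rewrite normrZ normfV normr_id mulVf.
have v1 : `|v| = 1 by rewrite normrZ normfV normr_id mulVf.
have := smoothness_modulus_ub (`|h| / `|x|) u1 v1.
have -> : (`|h| / `|x|) *: v = `|x|^-1 *: h.
  by rewrite scalerA -mulrA mulrCA mulfV// mulr1.
rewrite /u -scalerDr -scalerBr !normrZ normfV normr_id.
set s := smoothness_modulus _ _ => H.
have := ler_wpM2l (ltW nx) H.
rewrite mulrBr mulrA mulrDr !mulVKf//; lra.
Qed.

Lemma power_uniformly_smooth_uniformly_smooth q :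
  1 < q -> power_uniformly_smooth E q -> uniformly_smooth E.
Proof.
move=> q1 [K K0 HK].
apply: (@squeeze_cvgr _ _ _ _ (fun=> 0) (fun t => K * t `^ (q - 1))).
- near=> t.
  have t0 : 0 < t by near: t; exact: nbhs_right_gt.
  rewrite (divr_ge0 (smoothness_modulus_ge0 t) (ltW t0))/= ler_pdivrMr//.
  rewrite -mulrA -{3}(powRr1 (ltW t0)) -powRD ?subrK ?HK//.
  by rewrite (gt_eqF t0) implybT.
- exact: cvg_cst.
- rewrite -[X in _ --> X](mulr0 K); apply: cvgMr.
  by apply: powR_cvg0; rewrite subr_gt0.
Unshelve. all: by end_near. Qed.

End Modulus.

(** * Directional derivatives of the norm and nonempty duality sets *)

Section Gateaux.
Context {R : realType} {E : normedModType R}.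
Implicit Types (x h k : E) (s t : R).

Definition norm_slope x h t : R := (`|x + t *: h| - `|x|) / t.

(** The right derivative of the norm at [x] along [h]: the slopes decrease as [t] decreases to 0, so
    their limit is this infimum. *)
Definition norm_derive x h : R := inf [set norm_slope x h t | t in [set t | 0 < t]].

Lemma norm_slope_ge x h t : 0 < t -> - `|h| <= norm_slope x h t.
Proof.
move=> t0; rewrite ler_pdivlMr// mulNr.
have := ler_normB (x + t *: h) (t *: h).
rewrite addrK normrZ gtr0_norm//; lra.
Qed.

Lemma norm_slope_le x h t : 0 < t -> norm_slope x h t <= `|h|.
Proof.
move=> t0; rewrite ler_pdivrMr//.
have := ler_normD x (t *: h); rewrite normrZ gtr0_norm//; lra.
Qed.

(** Convexity of the norm: [x + s h] is a convex combination of [x] and [x + t h], here with the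
    denominator [t] cleared. *)
Lemma norm_slope_nondecreasing x h s t :
  0 < s -> s <= t -> norm_slope x h s <= norm_slope x h t.
Proof.
move=> s0 st; have t0 : 0 < t by lra.
rewrite ler_pdivrMr// mulrAC ler_pdivlMr//.
have := ler_normD ((t - s) *: x) (s *: (x + t *: h)).
have -> : (t - s) *: x + s *: (x + t *: h) = t *: (x + s *: h).
  by rewrite scalerBl !scalerDr addrA subrK !scalerA [s * t]mulrC.
rewrite !normrZ (gtr0_norm s0) (gtr0_norm t0) ger0_norm ?subr_ge0//; nra.
Qed.

Lemma norm_derive_le x h t : 0 < t -> norm_derive x h <= norm_slope x h t.
Proof.
move=> t0; apply: ge_inf; last by exists t.
by exists (- `|h|) => _ [s /= s0 <-]; exact: norm_slope_ge.
Qed.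

Lemma norm_derive_ge x h c :
  (forall t, 0 < t -> c <= norm_slope x h t) -> c <= norm_derive x h.
Proof.
move=> H; apply: lb_le_inf; first by exists (norm_slope x h 1), 1 => /=.
by move=> _ [t /= t0 <-]; exact: H.
Qed.

Lemma norm_derive_self x : norm_derive x x = `|x|.
Proof.
have slopeE t : 0 < t -> norm_slope x x t = `|x|.
  move=> t0; rewrite /norm_slope -{1}[x]scale1r -scalerDl normrZ gtr0_norm; last lra.
  by field; rewrite gt_eqF.
apply/eqP; rewrite eq_le; apply/andP; split.
  by rewrite -[leRHS](slopeE 1)// norm_derive_le.
by apply: norm_derive_ge => t t0; rewrite slopeE.
Qed.

Lemma norm_derive_norm_le x h : `|norm_derive x h| <= `|h|.
Proof.
rewrite ler_norml; apply/andP; split.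
  by apply: norm_derive_ge => t; exact: norm_slope_ge.
exact: le_trans (norm_derive_le x h ltr01) (norm_slope_le x h ltr01).
Qed.

Lemma norm_deriveD x h k :
  norm_derive x (h + k) <= norm_derive x h + norm_derive x k.
Proof.
rewrite -lerBlDr; apply: norm_derive_ge => s s0.
rewrite lerBlDr -lerBlDl; apply: norm_derive_ge => t t0.
rewrite lerBlDl.
(* Monotonicity of slopes gives a common step [r]; then [x + (r / 2) (h + k)] is the midpoint of
   [x + r h] and [x + r k]. *)
pose r := Num.min s t; have r0 : 0 < r by rewrite lt_min s0.
have hs : norm_slope x h r <= norm_slope x h s.
  by apply: norm_slope_nondecreasing; rewrite // ge_min lexx.
have ht : norm_slope x k r <= norm_slope x k t.
  by apply: norm_slope_nondecreasing; rewrite // ge_min lexx orbT.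
apply: (le_trans _ (lerD hs ht)).
apply: le_trans (norm_derive_le x (h + k) (_ : 0 < r / 2)) _; first lra.
rewrite /norm_slope -mulrDl ler_pdivrMr; last lra.
rewrite mulrA divfK ?gt_eqF//.
have := ler_normD (x + r *: h) (x + r *: k).
have -> : x + r *: h + (x + r *: k) = 2 *: (x + (r / 2) *: (h + k)).
  rewrite addrACA -scalerDr [RHS]scalerDr scalerA mulrCA divff ?mulr1//.
  by rewrite scaler_nat mulr2n.
rewrite normrZ ger0_norm//; lra.
Qed.

Lemma norm_deriveZ_le x h t :
  0 < t -> norm_derive x (t *: h) <= t * norm_derive x h.
Proof.
move=> t0; rewrite -ler_pdivrMl//; apply: norm_derive_ge => s s0.
rewrite ler_pdivrMl//.
apply: le_trans (norm_derive_le x (t *: h) (divr_gt0 s0 t0)) _.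
rewrite /norm_slope scalerA divfK ?gt_eqF// invf_div.
by rewrite mulrCA mulrA.
Qed.

Lemma norm_derive0 x : norm_derive x 0 = 0.
Proof.
by apply/eqP; rewrite -normr_le0 -[leRHS](@normr0 _ E) norm_derive_norm_le.
Qed.

Hypothesis smoothE : uniformly_smooth E.

(** One inequality is subadditivity. For the other, the slopes along [h] and [- h] add up to a
    second difference divided by [t], which uniform smoothness makes arbitrarily small. *)
Lemma norm_deriveN x h : x != 0 -> norm_derive x (- h) = - norm_derive x h.
Proof.
move=> x0; have nx : 0 < `|x| by rewrite normr_gt0.
have [->|h0] := eqVneq h 0; first by rewrite oppr0 norm_derive0 oppr0.
have nh : 0 < `|h| by rewrite normr_gt0.
apply/eqP; rewrite eq_le; apply/andP; split; last first.
  by rewrite -subr_ge0 opprK -[leLHS](norm_derive0 x) -(addNr h) norm_deriveD.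
rewrite -subr_le0 opprK; apply/ler_addgt0Pl => e e0; rewrite addr0.
have e1 : 0 < e / (2 * `|h|) by rewrite divr_gt0// mulr_gt0.
have /cvgrPdist_le/(_ _ e1) := smoothE.
move=> H.
near (0 : R)^'+ => s.
have s0 : 0 < s by near: s; exact: nbhs_right_gt.
have Hs : `|0 - smoothness_modulus E s / s| <= e / (2 * `|h|) by near: s.
(* Chosen so that [|t h| / |x| = s]; the second difference is then at most
   [2 |x| e s / (2 |h|) = e t]. *)
pose t := s * `|x| / `|h|.
have t0 : 0 < t by rewrite divr_gt0// mulr_gt0.
apply: le_trans (lerD (norm_derive_le x (- h) t0) (norm_derive_le x h t0)) _.
rewrite /norm_slope -mulrDl ler_pdivrMr//.
have := norm_second_difference (t *: h) x0.
have -> : `|t *: h| / `|x| = s.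
  by rewrite normrZ gtr0_norm// /t divfK ?gt_eqF// mulfK ?gt_eqF.
have : smoothness_modulus E s <= e * s / (2 * `|h|).
  move: Hs; rewrite sub0r normrN => /(le_trans (ler_norm _)).
  by rewrite ler_pdivrMr// mulrAC.
rewrite scalerN => A B.
have -> : e * t = 2 * `|x| * (e * s / (2 * `|h|)).
  by rewrite /t; field; rewrite gt_eqF.
have := ler_wpM2l (ltW nx) A; lra.
Unshelve. all: by end_near. Qed.

(** Oddness turns subadditivity into additivity and extends homogeneity from positive to all
    scalars. *)
Lemma norm_derive_linear x :
  x != 0 -> linear (norm_derive x : E -> R^o).
Proof.
move=> x0.
have dD h k : norm_derive x (h + k) = norm_derive x h + norm_derive x k.
  apply/eqP; rewrite eq_le norm_deriveD/= -lerBrDr -norm_deriveN//.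
  by rewrite -{1}(addrK k h) norm_deriveD.
have dZpos t h : 0 < t -> norm_derive x (t *: h) = t * norm_derive x h.
  move=> t0; apply/eqP; rewrite eq_le norm_deriveZ_le//=.
  by rewrite -lerN2 -norm_deriveN// -mulrN -norm_deriveN// -scalerN norm_deriveZ_le.
move=> t h k; rewrite dD; congr (_ + _).
have [t0|t0|->] := ltgtP t 0.
- rewrite -[t *: h]opprK -scaleNr norm_deriveN// dZpos ?oppr_gt0//.
  by rewrite mulNr opprK.
- exact: dZpos.
- by rewrite !scale0r norm_derive0.
Qed.

(** The witness is [|x|] times the derivative of the norm at [x], that is, the derivative of half
    the squared norm; its norm [|x|] is attained in the direction of [x]. *)
Lemma duality_set_nonempty x : duality_set x !=set0.
Proof.
have [->|x0] := eqVneq x 0.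
  by exists 0; split; rewrite ?normr0 ?expr0n.
have nx : 0 < `|x| by rewrite normr_gt0.
pose f : E -> R^o := fun h => `|x| * norm_derive x h.
have lf : linear f.
  move=> t h k; rewrite /f (norm_derive_linear x0) mulrDr; congr (_ + _).
  exact: mulrCA.
have fle h : `|f h| <= `|x| * `|h|.
  by rewrite normrM normr_id ler_wpM2l ?norm_derive_norm_le.
pose fL : {linear E -> R^o} := HB.pack f (GRing.isLinear.Build _ _ _ _ f lf).
have cf : continuous f.
  apply: (@bounded_linear_continuous _ _ _ fL); apply/linear_boundedP.
  apply: filterS (nbhs_pinfty_ge (num_real `|x|)) => M xM h.
  by apply: le_trans (fle h) _; exact: ler_wpM2r.
have fP : f \in @linear_continuous_pred R E by apply/asboolP; split.
exists (Dual fP); have fx : Dual fP x = `|x| ^+ 2.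
  by rewrite /= /f norm_derive_self.
split=> //; congr (_ ^+ 2); apply/eqP; rewrite eq_le; apply/andP; split.
  apply: dual_norm_le => h h1; apply: le_trans (fle h) _.
  by rewrite ler_piMr.
have := le_trans (ler_norm _) (dual_normM_ub (Dual fP) x).
by rewrite fx expr2 ler_pM2r.
Qed.

Lemma duality_mapP x : duality_set x (duality_map x).
Proof. by apply: xgetPex; exact: duality_set_nonempty. Qed.

End Gateaux.

(** * The Hölder estimate for the duality mapping *)

Section Estimate.
Context {R : realType} {E : normedModType R}.
Variables (q K : R).
Hypotheses (q12 : 1 < q <= 2) (K0 : 0 < K).
Hypothesis rhoK : forall t : R, 0 < t -> smoothness_modulus E t <= K * t `^ q.

Lemma sqr_le_powRM (u v : R) : 0 <= u -> u <= v -> u ^+ 2 <= u `^ q * v `^ (2 - q).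
Proof.
move=> u0 uv; have /andP[q1 q2] := q12.
rewrite -powR_mulrn// -[in leLHS](subrKC q 2%:R) powRD; last first.
  by rewrite subrKC pnatr_eq0.
rewrite ler_wpM2l ?powR_ge0// ge0_ler_powR ?nnegrE ?subr_ge0//.
exact: le_trans uv.
Qed.

(** With [a = |m + k|] and [b = |m - k|], the left side splits into a term with factor
    [a + b - 2 |m|], controlled by the modulus, and [(a - b)^2 / 2 <= 2 |k|^2]. *)
Lemma sqr_norm_second_difference (m k : E) (L : R) : `|m| <= L -> `|k| <= L ->
  `|m + k| ^+ 2 + `|m - k| ^+ 2 - 2 * `|m| ^+ 2 <=
    2 * (3 * K + 4) * (`|k| `^ q * L `^ (2 - q)).
Proof.
move=> mL kL; have /andP[q1 q2] := q12.
have k2 := sqr_le_powRM (normr_ge0 k) kL.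
set P := _ `^ q * _ in k2 *.
have P0 : 0 <= P by rewrite mulr_ge0 ?powR_ge0.
set a := `|m + k|; set b := `|m - k|.
have a_le : a <= `|m| + `|k| := ler_normD m k.
have b_le : b <= `|m| + `|k| := ler_normB m k.
have ab2 : (a - b) ^+ 2 <= 4 * `|k| ^+ 2.
  have : `|a - b| <= `|2 *: k|.
    apply: le_trans (ler_dist_dist _ _) _.
    by rewrite opprD opprK addrACA subrr add0r scaler_nat mulr2n.
  rewrite normrZ ger0_norm// => H.
  rewrite -[leLHS]real_normK ?num_real//.
  have := normr_ge0 (a - b); have := normr_ge0 k; nra.
have abm : 2 * `|m| <= a + b.
  apply: (le_trans _ (ler_normD _ _)).
  by rewrite addrACA subrr addr0 -mulr2n normrMn mulr_natl.
have sqrE : a ^+ 2 + b ^+ 2 - 2 * `|m| ^+ 2 =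
    (a + b - 2 * `|m|) * (a + b + 2 * `|m|) / 2 + (a - b) ^+ 2 / 2 by field.
rewrite sqrE.
(* If [|m| <= |k|], the triangle inequality alone gives [8 |k|^2 <= 8 P]; otherwise the modulus
   gives [(6 K + 2) P]. The constant [6 K + 8] covers both. *)
have [km|mk] := ltP `|k| `|m|; last first.
  have := normr_ge0 m; have := normr_ge0 k.
  have : (a + b - 2 * `|m|) * (a + b + 2 * `|m|) <= 2 * `|k| * (6 * `|k|).
    by apply: ler_pM; have := normr_ge0 m; lra.
  have := mulr_ge0 (ltW K0) P0; nra.
have nm : 0 < `|m| := le_lt_trans (normr_ge0 k) km.
have nm0 : m != 0 by rewrite -normr_gt0.
(* [rhoK] is available only at a positive argument [|k| / |m|]. *)
have [k0|k0] := eqVneq k 0.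
  by rewrite /a /b k0 subr0 addr0 subrr expr0n/=; have := mulr_ge0 (ltW K0) P0; nra.
have nk : 0 < `|k| by rewrite normr_gt0.
have := rhoK (divr_gt0 nk nm).
have := norm_second_difference k nm0.
rewrite -/a -/b; set s := smoothness_modulus _ _ => H1 H2.
have mP : `|m| ^+ 2 * (`|k| / `|m|) `^ q <= P.
  rewrite powRM ?invr_ge0// -powR_inv1// -powRrM mulN1r mulrCA.
  rewrite /P ler_wpM2l ?powR_ge0// -powR_mulrn// -powRD; last first.
    by rewrite (gt_eqF nm) implybT.
  by rewrite ge0_ler_powR ?nnegrE ?subr_ge0 ?(le_trans _ mL).
have : (a + b - 2 * `|m|) * (a + b + 2 * `|m|) <= 2 * `|m| * s * (6 * `|m|).
  by apply: ler_pM; lra.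
have : `|m| ^+ 2 * s <= K * P.
  apply: (le_trans _ (ler_wpM2l (ltW K0) mP)).
  by rewrite mulrCA ler_wpM2l// sqr_ge0.
nra.
Qed.

Lemma duality_set_hoelder (x y : E) (f g : dual E) :
  x != y -> duality_set x f -> duality_set y g ->
  `|f - g| <=
    4 * (3 * K + 4) * `|x - y| `^ (q - 1) * Num.max `|x| `|y| `^ (2 - q).
Proof.
move=> xy Jf Jg; have /andP[q1 q2] := q12.
set N := Num.max _ _; set w := `|x - y|.
have w0 : 0 < w by rewrite normr_gt0 subr_eq0.
have xN : `|x| <= N by rewrite le_max lexx.
have yN : `|y| <= N by rewrite le_max lexx orbT.
have N0 : 0 <= N := le_trans (normr_ge0 x) xN.
have bound z : `|z| <= 1 ->
    (f - g) z <= 4 * (3 * K + 4) * w `^ (q - 1) * N `^ (2 - q).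
  move=> z1.
  pose r := w / 2; pose m := 2^-1 *: (x + y); pose k := 2^-1 *: (x - y) + r *: z.
  have r0 : 0 < r by rewrite divr_gt0.
  have xE : x + r *: z = m + k.
    rewrite /m /k addrA -scalerDr addrACA subrr addr0 -mulr2n.
    by rewrite -(scaler_nat 2 x) scalerA mulVf ?scale1r.
  have yE : y - r *: z = m - k.
    rewrite /m /k opprD addrA -scalerBr opprB [x + y]addrC addrACA subrr addr0.
    by rewrite -mulr2n -(scaler_nat 2 y) scalerA mulVf ?scale1r.
  have m_le : 2 * `|m| <= `|x| + `|y|.
    by rewrite normrZ ger0_norm// mulVKf// ler_normD.
  have k_le : `|k| <= w.
    apply: le_trans (ler_normD _ _) _.
    rewrite !normrZ -/w (gtr0_norm w0) normfV ger0_norm//.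
    by have := ler_wpM2l (ltW w0) z1; lra.
  have w_le : w <= 2 * N by have := ler_normB x y; rewrite -/w; lra.
  have rzE (h : dual E) s : h (s *: z) = s * h z by exact: linearZ.
  have fz := duality_set_subgradient (r *: z) Jf.
  have gz := duality_set_subgradient (- r *: z) Jg.
  have fgz : r * (f - g) z <= (`|m + k| ^+ 2 + `|m - k| ^+ 2 - 2 * `|m| ^+ 2) / 2.
    rewrite dual_subE; move: fz gz; rewrite scaleNr xE yE -scaleNr !rzE => fz gz.
    have : 2 * `|m| ^+ 2 <= `|x| ^+ 2 + `|y| ^+ 2.
      have := sqr_ge0 (`|x| - `|y|); have := normr_ge0 m; nra.
    by rewrite mulrBr; lra.
  (* The common bound is [2 N] because [|k|] is only known to be at most [w <= 2 N]. *)
  have mN : `|m| <= 2 * N by lra.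
  have kN : `|k| <= 2 * N by lra.
  have sd := sqr_norm_second_difference mN kN.
  (* The factor [w] split off from [w^q] cancels against [r = w / 2], and [2^(2 - q) <= 2] because
     [q > 1]; hence the constant [4 (3 K + 4)]. *)
  have pow : `|k| `^ q * (2 * N) `^ (2 - q) <=
      w * (w `^ (q - 1)) * (2 * N `^ (2 - q)).
    apply: ler_pM; rewrite ?powR_ge0//.
      have -> : w * w `^ (q - 1) = w `^ q.
        rewrite -{1}(powRr1 (ltW w0)) -powRD ?subrKC//.
        by rewrite (gt_eqF w0) implybT.
      by rewrite ge0_ler_powR ?nnegrE//; lra.
    rewrite powRM// ler_wpM2r ?powR_ge0//.
    by rewrite -[leRHS](@powRr1 _ 2)// ler_powR//; lra.
  have c0 : 0 <= 2 * (3 * K + 4) by have := K0; lra.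
  have := le_trans sd (ler_wpM2l c0 pow).
  by move=> key; rewrite -(ler_pM2l r0); rewrite /r in fgz *; lra.
(* The lower bound is [bound] applied to [- z]. *)
apply: dual_norm_le => z z1; rewrite ler_norml bound// andbT lerNl.
by rewrite -linearN bound// normrN.
Qed.

End Estimate.

Theorem theorem3p2 (R : realType) (E : completeNormedModType R) :
  (forall q K : R, 1 < q <= 2 -> 0 < K ->
     uniformly_smooth E ->
     (forall t : R, 0 < t -> smoothness_modulus E t <= K * t `^ q) ->
     exists M : R, forall x y : E,
       `|duality_map x - duality_map y| <=
         M * `|x - y| `^ (q - 1) * Num.max `|x| `|y| `^ (2 - q))
  /\
  (power_uniformly_smooth E 2 -> lipschitz (@duality_map R E)).
Proof.
have hoelder (q K : R) : 1 < q <= 2 -> 0 < K -> uniformly_smooth E ->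
    (forall t : R, 0 < t -> smoothness_modulus E t <= K * t `^ q) ->
    exists M : R, forall x y : E,
      `|duality_map x - duality_map y| <=
        M * `|x - y| `^ (q - 1) * Num.max `|x| `|y| `^ (2 - q).
  move=> q12 K0 smoothE rhoK; exists (4 * (3 * K + 4)) => x y.
  (* The estimate divides by [|x - y|], so equal points are treated apart. *)
  have [->|xy] := eqVneq x y.
    by rewrite subrr normr0 !mulr_ge0 ?powR_ge0//; lra.
  by apply: duality_set_hoelder => //; exact: duality_mapP.
split=> // pE.
have smoothE : uniformly_smooth E.
  by apply: power_uniformly_smooth_uniformly_smooth pE; rewrite ltr1n.
have [K K0 rhoK] := pE.
have q12 : 1 < (2 : R) <= 2 by rewrite ltr1n lexx.
have [M JM] := hoelder 2 K q12 K0 smoothE rhoK.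
apply: (@klipschitzW _ _ _ M).
  exact: (@globally_properfilter _ _ (0, 0)).
move=> [x y] _ /=.
apply: le_trans (JM x y) _.
(* For [q = 2] the maximum has exponent 0, and the power is 1 even at base 0. *)
by rewrite subrr powRr0 mulr1 (_ : 2 - 1 = 1) ?powRr1//; lra.
Qed.
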